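(* Let $x=x_1x_2\cdots x_m$ be a plaintext (a word over an alphabet $\mathscr{A}$) divided into $m$ consecutive blocks $x_1,\dots,x_m$, not necessarily of the same size, with $|x_i|=s_i>1$ for every $i$. Let $\pi_i\in\mathfrak{S}_{s_i}$ for $1\le i\le m$, and let $y=\pi_1(x_1)\pi_2(x_2)\cdots\pi_m(x_m)$ be the ciphertext obtained from $x$ by permuting the letters of the block $x_i$ according to $\pi_i$ for every $i$. Let $\Lambda_{\mathscr{M}}$ be the Brauer configuration algebra defined by the plaintext $x=x_1\cdots x_m$, and let $\Lambda_{\mathscr{M}^{\pi_1,\dots,\pi_m}}$ be the Brauer configuration algebra defined by the ciphertext $y$ divided into the blocks $\pi_1(x_1),\dots,\pi_m(x_m)$. Then $$\Lambda_{\mathscr{M}}=\Lambda_{\mathscr{M}^{\pi_1,\dots,\pi_m}}.$$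
   Context: $\mathfrak{S}_s$ is the symmetric group on $s$ letters. For a word $z=z_{(1)}\cdots z_{(s)}$ and $\pi\in\mathfrak{S}_s$, $\pi(z)=z_{(\pi(1))}\cdots z_{(\pi(s))}$. $k$ is a field. Brauer configuration. A Brauer configuration $\mathscr{M}=(M,\mathscr{M}_1,\mu,\mathcal{O})$ consists of a finite set $M$ (vertices), a finite collection $\mathscr{M}_1$ of finite multisets (polygons, indexed, so repetitions are allowed) with elements in $M$, each polygon having at least two elements counted with multiplicity and every vertex lying in some polygon, a multiplicity function $\mu:M\to\{1,2,\dots\}$, and an orientation $\mathcal{O}$. The valency $val(v)$ of a vertex $v$ is the sum over all polygons of the number of occurrences of $v$ in the polygon. If the polygons are linearly ordered $U_1<\dots<U_m$, the successor sequence of $v$ is the list of polygons containing $v$ in this order, where $U_i$ is repeated (as consecutive distinct copies) as many times as $v$ occurs in $U_i$; the orientation makes this list into a circular order by declaring the first term to follow the last one. Brauer quiver. $Q_{\mathscr{M}}$ has one vertex for each polygon, and for each vertex $v\in M$ and each pair of consecutive terms $U<U'$ in the circular order of $v$ (including the step from the last term to the first) one arrow $U\to U'$; thus $v$ contributes $val(v)$ arrows (a single loop if $val(v)=1$). For each occurrence of $v$ in a polygon $U$, the special $v$-cycle at $U$ is the cycle of length $val(v)$ that starts at the corresponding copy of $U$ and runs once through the circular order of $v$. Brauer configuration algebra. $\Lambda_{\mathscr{M}}=kQ_{\mathscr{M}}/I$ where $I$ is generated by: (1) $C^{\mu(v)}-D^{\mu(w)}$ for all special $v$-cycles $C$ and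 special $w$-cycles $D$ at the same polygon; (2) $C^{\mu(v)}a$, where $C$ is a special $v$-cycle and $a$ is its first arrow; (3) $ab$, for arrows $a,b$ with $ab$ a path in $Q_{\mathscr{M}}$, unless $a,b$ are consecutive arrows in the circular order of one and the same vertex $v$ (where, if $val(v)=1$, the single loop is regarded as consecutive to itself). Brauer configuration defined by a text divided into blocks. A word $z=z_1z_2\cdots z_m$ over $\mathscr{A}$ divided into blocks $z_i$ with $|z_i|>1$ defines the Brauer configuration whose vertices are the letters occurring in $z$; whose polygons are $U_1,\dots,U_m$, where $U_i$ is the multiset of letters of the block $z_i$ (with the number of occurrences in $z_i$ as multiplicities); with $\mu(v)=1$ if $val(v)>1$ and $\mu(v)=2$ if $val(v)=1$; and with successor sequences built from the order $U_1<U_2<\dots<U_m$. The configuration is ''labeled'': each polygon also carries a permutation recording the order in which its letters are written in the block $z_i$. The Brauer configuration algebra defined by the text is the algebra of this configuration. *)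

(* Defs.v *)
From HB Require Import structures.
From mathcomp Require Import all_boot all_order all_algebra all_fingroup.
From mathcomp Require Import generic_quotient ring_quotient.
From mathcomp Require Import finmap multiset monalg.
From mathcomp Require Import boolp.

Set Implicit Arguments.
Unset Strict Implicit.
Unset Printing Implicit Defensive.

Import GRing.Theory.
Local Open Scope ring_scope.

(* Unital associative algebras over k. MathComp's algType only covers nonzero *)
(* algebras, whereas the path algebra of a quiver without vertices is zero.   *)
Record pz_algebra (k : pzRingType) := PzAlgebra {
  pza_ring :> pzRingType;
  pza_scale : k -> pza_ring -> pza_ring;
  pza_scaleA : forall a b v,
    pza_scale a (pza_scale b v) = pza_scale (a * b) v;
  pza_scale1r : left_id 1 pza_scale;
  pza_scaleDr : right_distributive pza_scale +%R;
  pza_scaleDl : forall v, {morph pza_scale^~ v : a b / a + b};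
  pza_scalerAl : forall a u v, pza_scale a (u * v) = pza_scale a u * v;
  pza_scalerAr : forall a u v, pza_scale a (u * v) = u * pza_scale a v
}.

Section IdealQuotient.
Variables (k : pzRingType) (R : pz_algebra k) (S : R -> Prop).
Local Notation "c *' x" := (pza_scale c x) (at level 40).

(* The two-sided ideal generated by S. *)
Inductive gen_ideal : R -> Prop :=
| GenIdeal x of S x : gen_ideal x
| GenIdeal0 : gen_ideal 0
| GenIdealD x y of gen_ideal x & gen_ideal y : gen_ideal (x + y)
| GenIdealMl a x of gen_ideal x : gen_ideal (a * x)
| GenIdealMr x a of gen_ideal x : gen_ideal (x * a).

Definition ideal_pred : {pred R} := fun x => `[< gen_ideal x >].

Fact ideal_pred_zmod_closed : zmod_closed ideal_pred.
Proof.
split=> [|x y /asboolP Ix /asboolP Iy]; apply/asboolP; first exact: GenIdeal0.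
by apply: GenIdealD => //; rewrite -mulN1r; apply: GenIdealMl.
Qed.
HB.instance Definition _ := GRing.isZmodClosed.Build R ideal_pred
  ideal_pred_zmod_closed.

Lemma ideal_predMl a x : x \in ideal_pred -> a * x \in ideal_pred.
Proof. by move=> /asboolP Ix; apply/asboolP; apply: GenIdealMl. Qed.
Lemma ideal_predMr a x : x \in ideal_pred -> x * a \in ideal_pred.
Proof. by move=> /asboolP Ix; apply/asboolP; apply: GenIdealMr. Qed.
Lemma ideal_predZ c (x : R) : x \in ideal_pred -> c *' x \in ideal_pred.
Proof. by move=> Ix; rewrite -[x]mul1r pza_scalerAl; apply: ideal_predMl. Qed.

Definition ideal_quotient_type : Type := Quotient.quot ideal_pred.
HB.instance Definition _ := GRing.Zmodule.on ideal_quotient_type.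

Let pi (x : R) : ideal_quotient_type := \pi_(Quotient.quot ideal_pred)%qT x.

Local Lemma pi_eqP x y : (pi x = pi y) <-> (x - y \in ideal_pred).
Proof. by rewrite Quotient.idealrBE; split=> [h|/eqP//]; apply/eqP. Qed.
Local Lemma reprK_pi u : pi (repr u) = u. Proof. exact: reprK. Qed.
Local Lemma piD x y : pi (x + y) = pi x + pi y.
Proof. by rewrite /pi /= [LHS]raddfD. Qed.

Definition quot_one : ideal_quotient_type := pi 1.
Definition quot_mul (u v : ideal_quotient_type) : ideal_quotient_type :=
  pi (repr u * repr v).
Definition quot_scale (c : k) (u : ideal_quotient_type) : ideal_quotient_type :=
  pi (c *' repr u).

Local Lemma quot_mulE x y : quot_mul (pi x) (pi y) = pi (x * y).
Proof.
apply/pi_eqP; set x' := repr (pi x); set y' := repr (pi y).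
have hx : x' - x \in ideal_pred by apply/pi_eqP; apply: reprK_pi.
have hy : y' - y \in ideal_pred by apply/pi_eqP; apply: reprK_pi.
have -> : x' * y' - x * y = (x' - x) * y' + x * (y' - y).
  by rewrite mulrBl mulrBr addrA subrK.
by apply: rpredD; [apply: ideal_predMr | apply: ideal_predMl].
Qed.

Local Lemma scaleB' c (x y : R) : c *' (x - y) = c *' x - c *' y.
Proof. by apply/eqP; rewrite eq_sym subr_eq -pza_scaleDr subrK. Qed.

Local Lemma quot_scaleE c (x : R) : quot_scale c (pi x) = pi (c *' x).
Proof.
apply/pi_eqP; rewrite -scaleB' ideal_predZ //; apply/pi_eqP; exact: reprK_pi.
Qed.

Local Lemma quotW (P : ideal_quotient_type -> Prop) :
  (forall x, P (pi x)) -> forall u, P u.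
Proof. by move=> h u; rewrite -[u]reprK_pi. Qed.

Fact quot_mulA : associative quot_mul.
Proof.
by elim/quotW=> x; elim/quotW=> y; elim/quotW=> z; rewrite !quot_mulE mulrA.
Qed.
Fact quot_mul1r : left_id quot_one quot_mul.
Proof. by elim/quotW=> x; rewrite quot_mulE mul1r. Qed.
Fact quot_mulr1 : right_id quot_one quot_mul.
Proof. by elim/quotW=> x; rewrite quot_mulE mulr1. Qed.
Fact quot_mulDl : left_distributive quot_mul +%R.
Proof.
elim/quotW=> x; elim/quotW=> y; elim/quotW=> z.
by rewrite -piD !quot_mulE mulrDl piD.
Qed.
Fact quot_mulDr : right_distributive quot_mul +%R.
Proof.
elim/quotW=> x; elim/quotW=> y; elim/quotW=> z.
by rewrite -piD !quot_mulE mulrDr piD.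
Qed.
HB.instance Definition _ := GRing.Zmodule_isPzRing.Build ideal_quotient_type
  quot_mulA quot_mul1r quot_mulr1 quot_mulDl quot_mulDr.

Fact quot_scaleA c d u : quot_scale c (quot_scale d u) = quot_scale (c * d) u.
Proof. by elim/quotW: u => x; rewrite !quot_scaleE pza_scaleA. Qed.
Fact quot_scale1r : left_id 1 quot_scale.
Proof. by elim/quotW=> x; rewrite quot_scaleE pza_scale1r. Qed.
Fact quot_scaleDr : right_distributive quot_scale +%R.
Proof.
move=> c; elim/quotW=> x; elim/quotW=> y.
by rewrite -piD !quot_scaleE pza_scaleDr piD.
Qed.
Fact quot_scaleDl u : {morph quot_scale^~ u : c d / c + d}.
Proof. by elim/quotW: u => x c d; rewrite !quot_scaleE pza_scaleDl piD. Qed.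
Fact quot_scalerAl c (u v : ideal_quotient_type) :
  quot_scale c (u * v) = quot_scale c u * v.
Proof.
elim/quotW: u => x; elim/quotW: v => y; rewrite -[pi x * _]/(quot_mul _ _).
by rewrite -[RHS]/(quot_mul _ _) !(quot_scaleE, quot_mulE) pza_scalerAl.
Qed.
Fact quot_scalerAr c (u v : ideal_quotient_type) :
  quot_scale c (u * v) = u * quot_scale c v.
Proof.
elim/quotW: u => x; elim/quotW: v => y; rewrite -[pi x * _]/(quot_mul _ _).
by rewrite -[RHS]/(quot_mul _ _) !(quot_scaleE, quot_mulE) pza_scalerAr.
Qed.

Definition ideal_quotient : pz_algebra k :=
  PzAlgebra quot_scaleA quot_scale1r quot_scaleDr quot_scaleDl
    quot_scalerAl quot_scalerAr.

End IdealQuotient.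

Record quiver := Quiver {
  qvertex : finType;
  qarrow : finType;
  qsource : qarrow -> qvertex;
  qtarget : qarrow -> qvertex
}.

Section Paths.
Variable Q : quiver.
Implicit Types (x : qvertex Q) (s : seq (qarrow Q)).

Fixpoint is_walk x s : bool :=
  if s is a :: s' then (qsource a == x) && is_walk (qtarget a) s' else true.

Definition walk_end x s : qvertex Q := last x (map (@qtarget Q) s).

Lemma is_walk_cat x s t :
  is_walk x (s ++ t) = is_walk x s && is_walk (walk_end x s) t.
Proof. by elim: s x => //= a s IHs x; rewrite IHs andbA. Qed.

Lemma walk_end_cat x s t : walk_end x (s ++ t) = walk_end (walk_end x s) t.
Proof. by rewrite /walk_end map_cat last_cat. Qed.

(* A path is a start vertex together with a composable list of arrows, written *)
(* in the order in which they are traversed; (x, [::]) is the trivial path.    *)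
Record qpath := QPath {
  qpath_val : qvertex Q * seq (qarrow Q);
  _ : is_walk qpath_val.1 qpath_val.2
}.
HB.instance Definition _ := [isSub for qpath_val].
HB.instance Definition _ := [Choice of qpath by <:].

Definition path_start (p : qpath) : qvertex Q := (val p).1.
Definition path_arrows (p : qpath) : seq (qarrow Q) := (val p).2.
Definition path_end (p : qpath) : qvertex Q :=
  walk_end (path_start p) (path_arrows p).

Definition trivial_path x : qpath := @QPath (x, [::]) isT.

Fact arrow_path_subproof (a : qarrow Q) : is_walk (qsource a) [:: a].
Proof. by rewrite /= eqxx. Qed.
Definition arrow_path (a : qarrow Q) : qpath :=
  @QPath (qsource a, [:: a]) (arrow_path_subproof a).

(* The composite p q, first p and then q. *)
Definition path_cat (p q : qpath) : option qpath :=
  if path_end p == path_start q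
  then insub (path_start p, path_arrows p ++ path_arrows q) else None.

Variant path_cat_spec (p q : qpath) : option qpath -> Prop :=
| PathCatSome r of path_end p = path_start q & path_start r = path_start p
    & path_arrows r = path_arrows p ++ path_arrows q
    : path_cat_spec p q (Some r)
| PathCatNone of path_end p <> path_start q : path_cat_spec p q None.

Lemma path_catP p q : path_cat_spec p q (path_cat p q).
Proof.
rewrite /path_cat; case: eqP => [e|ne]; last exact: PathCatNone.
case: insubP => [r _ vr|] /=.
  by apply: PathCatSome; rewrite // /path_start /path_arrows vr.
case/negP; rewrite is_walk_cat; apply/andP; split; first exact: (valP p).
by move: e; rewrite /path_end => ->; apply: (valP q).
Qed.

Lemma qpath_eq (p q : qpath) :
  path_start p = path_start q -> path_arrows p = path_arrows q -> p = q.
Proof.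
rewrite /path_start /path_arrows => es ea; apply: val_inj.
by rewrite /= [LHS]surjective_pairing es ea -surjective_pairing.
Qed.

Lemma path_cat_some p q r : path_cat p q = Some r ->
  [/\ path_end p = path_start q, path_start r = path_start p,
      path_arrows r = path_arrows p ++ path_arrows q
    & path_end r = path_end q].
Proof.
case: path_catP => // r' e es ea [<-]; split=> //.
by rewrite /path_end es ea walk_end_cat -[walk_end _ (path_arrows p)]/(path_end p) e.
Qed.

Lemma path_cat_none p q : path_cat p q = None -> path_end p <> path_start q.
Proof. by case: path_catP. Qed.

Lemma path_catA p q r :
  obind (path_cat^~ r) (path_cat p q) = obind (path_cat p) (path_cat q r).
Proof.
case epq: (path_cat p q) => [u|]; case eqr: (path_cat q r) => [w|] //=.
- have [e1 s1 a1 t1] := path_cat_some epq.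
  have [e2 s2 a2 t2] := path_cat_some eqr.
  case: path_catP => [x fx gx hx|]; last by rewrite t1 e2.
  case: path_catP => [y fy gy hy|]; last by rewrite s2 e1.
  by congr Some; apply: qpath_eq; rewrite ?gx ?gy // hx hy a1 a2 catA.
- have [_ _ _ t1] := path_cat_some epq; have := path_cat_none eqr.
  by case: path_catP => // x; rewrite t1.
- have [_ s2 _ _] := path_cat_some eqr; have := path_cat_none epq.
  by case: path_catP => // x; rewrite s2.
Qed.

Lemma path_cat_triviall x p :
  path_cat (trivial_path x) p = if x == path_start p then Some p else None.
Proof.
case: path_catP => [r|]; rewrite /path_end /walk_end /path_start /=.
  move=> e es ea; rewrite -e eqxx; congr Some; apply: qpath_eq => //.
  by rewrite /path_start es.
by move=> ne; case: eqP.
Qed.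

Lemma path_cat_trivialr x p :
  path_cat p (trivial_path x) = if path_end p == x then Some p else None.
Proof.
case: path_catP => [r|] /=.
  move=> /= -> es ea; rewrite eqxx; congr Some; apply: qpath_eq => //.
  by rewrite ea cats0.
by move=> ne; case: eqP.
Qed.

End Paths.

Section PathAlgebra.
Variables (k : fieldType) (Q : quiver).

(* Finite k-linear combinations of paths. *)
Definition path_algebra : Type := {malg k[qpath Q]}.
HB.instance Definition _ := GRing.Lmodule.copy path_algebra {malg k[qpath Q]}.
Implicit Types (f g h : path_algebra) (p q r : qpath Q).

Definition path_elt (p : qpath Q) : path_algebra := << p >>.
Definition arrow_elt (a : qarrow Q) : path_algebra := path_elt (arrow_path a).

Definition path_mul p q : path_algebra := oapp path_elt 0 (path_cat p q).

Definition pa_one : path_algebra := \sum_x path_elt (trivial_path x).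
Definition pa_mul f g : path_algebra :=
  \sum_(p <- msupp f) \sum_(q <- msupp g) (f@_p * g@_q) *: path_mul p q.

Local Lemma path_eltZ c p : c *: path_elt p = << c *g p >> :> path_algebra.
Proof.
apply/malgP => q; rewrite /path_elt mcoeffZ [in LHS]mcoeffU mulrnAr mulr1.
by symmetry; apply: mcoeffU.
Qed.

Local Lemma pa_mulw (d1 d2 : {fset qpath Q}) f g :
  (msupp f `<=` d1)%fset -> (msupp g `<=` d2)%fset ->
  pa_mul f g = \sum_(p <- d1) \sum_(q <- d2) (f@_p * g@_q) *: path_mul p q.
Proof.
move=> le1 le2; rewrite /pa_mul (big_fset_incl _ le1) /=.
  apply/eq_bigr=> p _; apply/big_fset_incl => // q _ /mcoeff_outdom ->.
  by rewrite mulr0 scale0r.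
move=> p _ /mcoeff_outdom fp.
by rewrite big1 => // q _; rewrite fp mul0r scale0r.
Qed.

Fact pa_mulDl : left_distributive pa_mul +%R.
Proof.
move=> f1 f2 g; set d := (msupp f1 `|` msupp f2)%fset.
rewrite (@pa_mulw d (msupp g) (f1 + f2)) ?msuppD_le //.
rewrite (@pa_mulw d (msupp g) f1) ?fsubsetUl //.
rewrite (@pa_mulw d (msupp g) f2) ?fsubsetUr // -big_split /=.
apply: eq_bigr => p _; rewrite -big_split /=; apply: eq_bigr => q _.
by rewrite mcoeffD mulrDl scalerDl.
Qed.

Fact pa_mulDr : right_distributive pa_mul +%R.
Proof.
move=> f g1 g2; set d := (msupp g1 `|` msupp g2)%fset.
rewrite (@pa_mulw (msupp f) d _ (g1 + g2)) ?msuppD_le //.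
rewrite (@pa_mulw (msupp f) d _ g1) ?fsubsetUl //.
rewrite (@pa_mulw (msupp f) d _ g2) ?fsubsetUr // -big_split /=.
apply: eq_bigr => p _; rewrite -big_split /=; apply: eq_bigr => q _.
by rewrite mcoeffD mulrDr scalerDl.
Qed.

Local Lemma pa_mulZl (c : k) f g : pa_mul (c *: f) g = c *: pa_mul f g.
Proof.
rewrite (@pa_mulw (msupp f) (msupp g)) ?msuppZ_le // scaler_sumr.
apply: eq_bigr => p _; rewrite scaler_sumr; apply: eq_bigr => q _.
by rewrite mcoeffZ scalerA mulrA.
Qed.

Local Lemma pa_mulZr (c : k) f g : pa_mul f (c *: g) = c *: pa_mul f g.
Proof.
rewrite (@pa_mulw (msupp f) (msupp g)) ?msuppZ_le // scaler_sumr.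
apply: eq_bigr => p _; rewrite scaler_sumr; apply: eq_bigr => q _.
by rewrite mcoeffZ scalerA mulrCA.
Qed.

Local Lemma pa_mul0l g : pa_mul 0 g = 0.
Proof. by rewrite /pa_mul msupp0 big_seq_fset0. Qed.
Local Lemma pa_mul0r f : pa_mul f 0 = 0.
Proof. by rewrite /pa_mul big1 // => p _; rewrite msupp0 big_seq_fset0. Qed.

Local Lemma pa_mulUU p q : pa_mul (path_elt p) (path_elt q) = path_mul p q.
Proof.
rewrite (pa_mulw msuppU_le msuppU_le) !big_seq_fset1 !mcoeffUU.
by rewrite mulr1 scale1r.
Qed.

Local Lemma pa_ind (P : path_algebra -> Prop) :
  P 0 -> (forall u v, P u -> P v -> P (u + v)) ->
  (forall c f, P f -> P (c *: f)) -> (forall p, P (path_elt p)) ->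
  forall f, P f.
Proof.
move=> P0 PD PZ PU f; rewrite [f]monalgE; elim/big_ind: _ => // p _.
by rewrite -path_eltZ; apply: PZ.
Qed.

Local Lemma bilinear_assoc (V : lmodType k) (I : Type) (elt : I -> V)
    (cat : I -> I -> option I) (mul : V -> V -> V) :
  (forall P : V -> Prop, P 0 -> (forall u v, P u -> P v -> P (u + v)) ->
    (forall c u, P u -> P (c *: u)) -> (forall i, P (elt i)) ->
    forall u, P u) ->
  left_distributive mul +%R -> right_distributive mul +%R ->
  (forall c u v, mul (c *: u) v = c *: mul u v) ->
  (forall c u v, mul u (c *: v) = c *: mul u v) ->
  left_zero 0 mul -> right_zero 0 mul ->
  (forall i j, mul (elt i) (elt j) = oapp elt 0 (cat i j)) ->
  (forall i j l, obind (cat^~ l) (cat i j) = obind (cat i) (cat j l)) ->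
  associative mul.
Proof.
move=> ind Dl Dr Zl Zr m0l m0r mE catA.
elim/ind => [g h|f f' IH IH' g h|c f IH g h|p].
- by rewrite !m0l.
- by rewrite !Dl IH IH'.
- by rewrite !Zl IH.
elim/ind => [h|g g' IH IH' h|c g IH h|q].
- by rewrite m0l !m0r m0l.
- by rewrite !(Dl, Dr) IH IH'.
- by rewrite !(Zl, Zr) IH.
elim/ind => [|h h' IH IH'|c h IH|r].
- by rewrite !m0r.
- by rewrite !Dr IH IH'.
- by rewrite !Zr IH.
rewrite !mE; move: (catA p q r); case: (cat p q) => [u|]; case: (cat q r) => [w|].
- by rewrite /= !mE => ->.
- by rewrite /= mE m0r => ->.
- by rewrite /= mE m0l => <-.
- by rewrite /= m0l m0r.
Qed.

Fact pa_mulA : associative pa_mul.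
Proof.
exact: (bilinear_assoc pa_ind pa_mulDl pa_mulDr pa_mulZl pa_mulZr pa_mul0l
  pa_mul0r pa_mulUU (@path_catA Q)).
Qed.

Fact pa_mul1r : left_id pa_one pa_mul.
Proof.
elim/pa_ind => [|f g IHf IHg|c f IH|p].
- exact: pa_mul0r.
- by rewrite pa_mulDr IHf IHg.
- by rewrite pa_mulZr IH.
have -> : pa_mul pa_one (path_elt p)
    = \sum_x pa_mul (path_elt (trivial_path x)) (path_elt p).
  rewrite /pa_one; elim/big_rec2: _ => [|x y1 y2 _ <-]; first exact: pa_mul0l.
  exact: pa_mulDl.
rewrite (bigD1 (path_start p)) //= pa_mulUU /path_mul path_cat_triviall eqxx.
rewrite big1 ?addr0 // => x /negbTE ne.
by rewrite pa_mulUU /path_mul path_cat_triviall ne.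
Qed.

Fact pa_mulr1 : right_id pa_one pa_mul.
Proof.
elim/pa_ind => [|f g IHf IHg|c f IH|p].
- exact: pa_mul0l.
- by rewrite pa_mulDl IHf IHg.
- by rewrite pa_mulZl IH.
have -> : pa_mul (path_elt p) pa_one
    = \sum_x pa_mul (path_elt p) (path_elt (trivial_path x)).
  rewrite /pa_one; elim/big_rec2: _ => [|x y1 y2 _ <-]; first exact: pa_mul0r.
  exact: pa_mulDr.
rewrite (bigD1 (path_end p)) //= pa_mulUU /path_mul path_cat_trivialr eqxx.
rewrite big1 ?addr0 // => x; rewrite eq_sym => /negbTE ne.
by rewrite pa_mulUU /path_mul path_cat_trivialr ne.
Qed.

HB.instance Definition _ := GRing.Zmodule_isPzRing.Build path_algebra
  pa_mulA pa_mul1r pa_mulr1 pa_mulDl pa_mulDr.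

Fact pa_scalerAl (c : k) (f g : path_algebra) : c *: (f * g) = (c *: f) * g.
Proof. by rewrite [RHS]pa_mulZl. Qed.
Fact pa_scalerAr (c : k) (f g : path_algebra) : c *: (f * g) = f * (c *: g).
Proof. by rewrite [RHS]pa_mulZr. Qed.

Definition path_pz_algebra : pz_algebra k :=
  @PzAlgebra k path_algebra (fun c f => c *: f) (@scalerA _ _) (@scale1r _ _)
    (@scalerDr _ _) (@scalerDl _ _) pa_scalerAl pa_scalerAr.

End PathAlgebra.

Section BrauerConfiguration.
Variable A : choiceType.

Definition family_valency m (U : 'I_m -> {mset A}%mset) (v : A) : nat :=
  (\sum_(i < m) U i v)%N.

(* The orientation at v is a list of the polygons containing v, with          *)
(* multiplicity, to be read cyclically: the first term follows the last one.  *)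
Record brauer_config := BrauerConfig {
  bc_vertices : {fset A};
  bc_size : nat;
  bc_polygon : 'I_bc_size -> {mset A}%mset;
  bc_polygon_vertices : forall i v, v \in bc_polygon i -> v \in bc_vertices;
  bc_polygon_gt1 : forall i, (1 < size (bc_polygon i))%N;
  bc_vertices_polygon :
    forall v, v \in bc_vertices -> exists i, v \in bc_polygon i;
  bc_mult : bc_vertices -> nat;
  bc_mult_gt0 : forall v, (0 < bc_mult v)%N;
  bc_succ : bc_vertices -> seq 'I_bc_size;
  bc_succ_count : forall v i, count_mem i (bc_succ v) = bc_polygon i (val v)
}.

Variable M : brauer_config.

Definition valency (v : bc_vertices M) : nat :=
  family_valency (@bc_polygon M) (val v).

Fact bc_succ_size v : size (bc_succ v) == valency v.
Proof.
apply/eqP; rewrite /valency /family_valency.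
under eq_bigr do rewrite -bc_succ_count.
rewrite -(@count_predT _ (bc_succ v)); elim: (bc_succ v) => [|j s IHs] /=.
  by rewrite big1.
rewrite big_split /= -IHs (bigD1 j) //= eqxx big1 // => i.
by rewrite eq_sym => /negbTE ->.
Qed.
Definition succ_tuple v : (valency v).-tuple 'I_(bc_size M) :=
  Tuple (bc_succ_size v).

(* The arrow (v, j) goes from the j-th term of the circular order of v to the *)
(* next one; ordS is the cyclic successor on ordinals, so that (v, j) is a    *)
(* loop followed by itself when v has valency 1.                              *)
Definition brauer_arrow : finType := {v : bc_vertices M & 'I_(valency v)}.
Definition barrow (v : bc_vertices M) (j : 'I_(valency v)) : brauer_arrow :=
  Tagged (fun v => 'I_(valency v)) j.

Definition brauer_quiver : quiver := {|
  qvertex := 'I_(bc_size M);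
  qarrow := brauer_arrow;
  qsource := fun a => tnth (succ_tuple (tag a)) (tagged a);
  qtarget := fun a => tnth (succ_tuple (tag a)) (ordS (tagged a))
|}.

Definition next_arrow (a : brauer_arrow) : brauer_arrow :=
  barrow (ordS (tagged a)).

(* The special v-cycle starting at the j-th term of the circular order of v.  *)
Fact special_cycle_subproof v (j : 'I_(valency v)) :
  @is_walk brauer_quiver (tnth (succ_tuple v) j)
    (traject next_arrow (barrow j) (valency v)).
Proof.
suff walk n i : @is_walk brauer_quiver (tnth (succ_tuple v) i)
    (traject next_arrow (barrow i) n) by apply: walk.
by elim: n i => //= n IHn i; rewrite eqxx; apply: IHn.
Qed.
Definition special_cycle v (j : 'I_(valency v)) : qpath brauer_quiver :=
  @QPath brauer_quiver
    (tnth (succ_tuple v) j, traject next_arrow (barrow j) (valency v))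
    (special_cycle_subproof j).

Variable k : fieldType.

Local Notation cycle_elt j := (path_elt k (special_cycle j)).

Inductive brauer_relation : path_algebra k brauer_quiver -> Prop :=
| BrauerRel1 v (i : 'I_(valency v)) w (j : 'I_(valency w))
    of tnth (succ_tuple v) i = tnth (succ_tuple w) j :
    brauer_relation (cycle_elt i ^+ bc_mult v - cycle_elt j ^+ bc_mult w)
| BrauerRel2 v (i : 'I_(valency v)) :
    brauer_relation
      (cycle_elt i ^+ bc_mult v * arrow_elt k (barrow i : qarrow brauer_quiver))
| BrauerRel3 (a b : qarrow brauer_quiver)
    of qtarget a = qsource b & b <> next_arrow a :
    brauer_relation (arrow_elt k a * arrow_elt k b).

Definition brauer_algebra : pz_algebra k :=
  @ideal_quotient k (path_pz_algebra k brauer_quiver) brauer_relation.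

End BrauerConfiguration.

(* pi(z) = z_(pi(1)) ... z_(pi(s)) *)
Definition permute_word (T : Type) (s : nat) (pi : 'S_s) (z : s.-tuple T) :
  s.-tuple T := [tuple tnth z (pi i) | i < s].

(* The label of a polygon U is a permutation of the positions of its elements,*)
(* taken relatively to the enumeration of U as a multiset.                    *)
Record labeled_brauer_config (A : choiceType) := LabeledBrauerConfig {
  lbc_config :> brauer_config A;
  lbc_label : forall i : 'I_(bc_size lbc_config),
    'S_(size (enum_mset (bc_polygon i)))
}.

Section TextConfiguration.
Variables (A : choiceType) (m : nat) (s : 'I_m -> nat).
Hypothesis s_gt1 : forall i, (1 < s i)%N.
Variable z : forall i, (s i).-tuple A.

Definition text_word : seq A := flatten [seq tval (z i) | i <- enum 'I_m].

Definition text_vertices : {fset A} := [fset a in text_word]%fset.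

Definition text_polygon (i : 'I_m) : {mset A}%mset := seq_mset (z i).

Definition text_mult (v : text_vertices) : nat :=
  if family_valency text_polygon (val v) == 1%N then 2 else 1.

Definition text_succ (v : text_vertices) : seq 'I_m :=
  flatten [seq nseq (text_polygon i (val v)) i | i <- enum 'I_m].

Lemma mem_text_polygon i a : (a \in text_polygon i) = (a \in z i).
Proof. by rewrite (perm_mem (perm_eq_seq_mset (z i))). Qed.

Fact text_polygon_vertices i v : v \in text_polygon i -> v \in text_vertices.
Proof.
rewrite mem_text_polygon inE /= => vz; apply/flatten_mapP.
by exists i => //; rewrite mem_enum.
Qed.

Fact text_polygon_gt1 i : (1 < size (text_polygon i))%N.
Proof. by rewrite (perm_size (perm_eq_seq_mset (z i))) size_tuple. Qed.

Fact text_vertices_polygon v :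
  v \in text_vertices -> exists i, v \in text_polygon i.
Proof.
by rewrite inE /= => /flatten_mapP[i _ vz]; exists i; rewrite mem_text_polygon.
Qed.

Fact text_mult_gt0 v : (0 < text_mult v)%N.
Proof. by rewrite /text_mult; case: ifP. Qed.

Fact text_succ_count v i :
  count_mem i (text_succ v) = text_polygon i (val v).
Proof.
rewrite count_flatten sumnE 2!big_map big_enum /= (bigD1 i) //=.
rewrite count_nseq /= eqxx mul1n big1 ?addn0 // => j /negbTE ne.
by rewrite count_nseq /= ne.
Qed.

Definition text_brauer_config : brauer_config A :=
  BrauerConfig text_polygon_vertices text_polygon_gt1 text_vertices_polygon
    text_mult_gt0 text_succ_count.

Fact text_label_subproof i :
  exists sigma : 'S_(size (enum_mset (text_polygon i))),
    tval (z i) == permute_word sigma (in_tuple (enum_mset (text_polygon i))).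
Proof.
have /tuple_permP[sigma zE] :
    perm_eq (z i) (in_tuple (enum_mset (text_polygon i))).
  by rewrite perm_sym perm_eq_seq_mset.
by exists sigma; apply/eqP.
Qed.

(* A permutation writing the letters of the polygon in the order of z_i. *)
Definition text_label i : 'S_(size (enum_mset (text_polygon i))) :=
  xchoose (text_label_subproof i).

Definition text_config : labeled_brauer_config A :=
  @LabeledBrauerConfig A text_brauer_config text_label.

End TextConfiguration.

(* Main.v *)
Require Import Defs.
From mathcomp Require Import all_boot all_order all_algebra all_fingroup.
From mathcomp Require Import finmap multiset boolp.

Set Implicit Arguments.
Unset Strict Implicit.
Unset Printing Implicit Defensive.

(** [brauer_algebra] sees only the underlying configuration, not the labels. Everything in that
    configuration is determined by the multisets of letters of the blocks, which permuting letters
    inside a block preserves. So the two configurations are equal, not merely isomorphic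
    ([text_brauer_config_perm]), and hence so are the algebras. *)

(* Multiplicities and orientations are taken as restrictions of functions on   *)
(* the whole alphabet, so that no transport along V = V' is needed.            *)
Lemma BrauerConfig_eq (A : choiceType) (n : nat) (V V' : {fset A})
    (U U' : 'I_n -> {mset A}%mset) (mu mu' : A -> nat) (o o' : A -> seq 'I_n)
    UV UV' U_gt1 U_gt1' VU VU' mu_gt0 mu_gt0' oU oU' :
  V = V' -> U = U' -> mu = mu' -> o = o' ->
  @BrauerConfig A V n U UV U_gt1 VU (fun v => mu (val v)) mu_gt0
    (fun v => o (val v)) oU =
  @BrauerConfig A V' n U' UV' U_gt1' VU' (fun v => mu' (val v)) mu_gt0'
    (fun v => o' (val v)) oU'.
Proof.
move=> eV eU em eo; subst V' U' mu' o'.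
by rewrite (Prop_irrelevance UV UV') (Prop_irrelevance U_gt1 U_gt1')
  (Prop_irrelevance VU VU') (Prop_irrelevance mu_gt0 mu_gt0')
  (Prop_irrelevance oU oU').
Qed.

Lemma text_brauer_config_perm (A : choiceType) (m : nat) (s s' : 'I_m -> nat)
    (s_gt1 : forall i, (1 < s i)%N) (s'_gt1 : forall i, (1 < s' i)%N)
    (z : forall i, (s i).-tuple A) (z' : forall i, (s' i).-tuple A) :
  (forall i, perm_eq (z i) (z' i)) ->
  text_brauer_config s_gt1 z = text_brauer_config s'_gt1 z'.
Proof.
move=> zz'.
have eU : text_polygon z = text_polygon z'.
  by apply/funext => i; apply/eq_seq_msetP.
have eV : text_vertices z = text_vertices z'.
  apply/fsetP => a; rewrite !inE /=; apply/flatten_mapP/flatten_mapP.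
    by case=> i im az; exists i; rewrite // -(perm_mem (zz' i)).
  by case=> i im az; exists i; rewrite // (perm_mem (zz' i)).
rewrite /text_brauer_config /text_mult /text_succ.
(* Abstracting the polygon family [U], and letting [a] be any letter, reduces the equality of
   multiplicities and of orientations to [eU]. *)
pose mu U a := if @family_valency A m U a == 1%N then 2 else 1.
pose o (U : 'I_m -> {mset A}%mset) a :=
  flatten [seq nseq (U i a) i | i <- enum 'I_m].
apply: (@BrauerConfig_eq _ _ _ _ _ _ (mu (text_polygon z))
  (mu (text_polygon z')) (o (text_polygon z)) (o (text_polygon z'))) => //.
- by rewrite eU.
- by rewrite eU.
Qed.

Lemma perm_permute_word (T : eqType) (n : nat) (sigma : 'S_n)
    (z : n.-tuple T) :
  perm_eq (permute_word sigma z) z.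
Proof. by apply/tuple_permP; exists sigma. Qed.

Theorem theorem1 (k : fieldType) (A : choiceType) (m : nat) (s : 'I_m -> nat)
    (s_gt1 : forall i : 'I_m, (1 < s i)%N)
    (x : forall i : 'I_m, (s i).-tuple A)
    (pi : forall i : 'I_m, 'S_(s i)) :
  let y : forall i : 'I_m, (s i).-tuple A := fun i => permute_word (pi i) (x i) in
  brauer_algebra (text_config s_gt1 x) k = brauer_algebra (text_config s_gt1 y) k.
Proof.
(* Simplification projects away the labels, the only data in which the two labeled configurations
   may differ. *)
move=> y /=; rewrite (text_brauer_config_perm s_gt1 s_gt1 (z' := y)) // => i.
by rewrite perm_sym perm_permute_word.
Qed.
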